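(* Let $q:\mathsf D\to\mathbb R$ have sensitivity $\Delta q\in(0,\infty)$, and let $\mu\in\mathbb R$, $\sigma>0$, $0\le a<b\le\infty$. If $\Lambda$ has the Gaussian $\mathcal N(\mu,\sigma^2)$ distribution truncated to $[a,b]$, then the Randomized DP Laplace mechanism with reciprocal scale $\Lambda$ satisfies $\epsilon_{N^T}$-differential privacy, where $$\epsilon_{N^T}=\ln\left[\frac{\mu+\dfrac{\sigma(\phi(\alpha)-\phi(\beta))}{\Phi(\beta)-\Phi(\alpha)}}{M'_{\Lambda}(-\Delta q)}\right],\qquad \alpha=\frac{a-\mu}{\sigma},\ \beta=\frac{b-\mu}{\sigma},$$ $\phi$ and $\Phi$ being the standard normal density and distribution function, and $M'_\Lambda(-\Delta q)=\frac{dM_\Lambda(t)}{dt}\big|_{t=-\Delta q}$.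
   Context: Databases form a set $\mathsf D$ with a symmetric adjacency relation; the sensitivity of $q$ is $\Delta q=\sup\{|q(d)-q(d')|:d,d'\text{ adjacent}\}$. A mechanism $M$ is $\epsilon$-DP if $\mathbb P(M(d)\in S)\le e^\epsilon\mathbb P(M(d')\in S)$ for all adjacent $d,d'$ and Borel $S$. The truncated Gaussian on $[a,b]$ has density $\frac{\phi((x-\mu)/\sigma)}{\sigma(\Phi(\beta)-\Phi(\alpha))}$ for $a\le x\le b$ and $0$ otherwise. The Randomized DP Laplace mechanism with reciprocal-scale distribution $\Lambda$ (a random variable with values in $[0,\infty)$, positive a.s., playing the role of $1/b$ for the Laplace scale) is defined by $\mathcal M_q(d)=q(d)+W$, where conditionally on $\Lambda=\lambda$ the noise $W$ is Laplace with mean $0$ and scale $1/\lambda$, i.e. has density $\frac{\lambda}{2}e^{-\lambda|w|}$; the pair $(\Lambda,W)$ is drawn independently of $d$. $M_\Lambda(t)=\mathbb E[e^{t\Lambda}]$. *)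

(* Defs.v *)
From HB Require Import structures.
From mathcomp Require Import all_boot all_order all_algebra.
From mathcomp Require Import all_classical all_reals all_analysis.
Set Implicit Arguments.
Unset Strict Implicit.
Unset Printing Implicit Defensive.
Import Order.TTheory GRing.Theory Num.Theory.
Import numFieldNormedType.Exports.
Local Open Scope classical_set_scope.
Local Open Scope ring_scope.

Section defs.
Context {R : realType}.

Definition std_phi (x : R) : R := normal_pdf 0 1 x.

(* phi extended to \bar R by its limits (0 at +-oo) *)
Definition std_phi_bar (x : \bar R) : R :=
  match x with EFin r => std_phi r | _ => 0 end.

Definition std_Phi (t : \bar R) : R :=
  fine (\int[lebesgue_measure]_(x in [set x : R | (x%:E <= t)%E]) (std_phi x)%:E)%E.

Definition sensitivity (D : Type) (adj : D -> D -> Prop) (q : D -> R) : \bar R :=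
  ereal_sup [set r | exists d d', adj d d' /\ r = (`|q d - q d'|)%:E].

Definition itv_ab (a : R) (b : \bar R) : set R :=
  [set x | a <= x /\ (x%:E <= b)%E].

Definition trunc_gauss_pdf (mu sigma a : R) (b : \bar R) (x : R) : R :=
  let alpha := ((a - mu) / sigma)%:E in
  let beta := ((b - mu%:E) * (sigma^-1)%:E)%E in
  if `[< itv_ab a b x >] then
    normal_pdf mu sigma x / (std_Phi beta - std_Phi alpha)
  else 0.

Definition mgf (PL : probability R R) (t : R) : R :=
  fine (\int[PL]_l (expR (t * l))%:E)%E.

(* Randomized DP Laplace mechanism: law of q(d) + W, where given Lambda = l,
   W has density l/2 exp(-l|w|); i.e.
   P(M_q(d) \in S) = E_Lambda [ \int_S l/2 exp(-l |x - q d|) dx ]. *)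
Definition rlap_mech (PL : probability R R) (D : Type) (q : D -> R) (d : D)
    (S : set R) : \bar R :=
  (\int[PL]_l \int[lebesgue_measure]_(x in S)
       (l / 2 * expR (- (l * `|x - q d|)))%:E)%E.

Definition eps_DP (D : Type) (adj : D -> D -> Prop)
    (M : D -> set R -> \bar R) (eps : R) : Prop :=
  forall d d', adj d d' -> forall S : set R, measurable S ->
    (M d S <= (expR eps)%:E * M d' S)%E.

End defs.

(* Main.v *)
(** By Tonelli, the mechanism has density [x |-> G `|x - q d| / 2] with
    [G u = E (Lambda * exp (- Lambda * u))]. As [G] is nonincreasing, the ratio of two
    adjacent densities is at most [G u / G (u + Dq)], and Chebyshev's association
    inequality for the measure [l * PL] bounds this by its value [G 0 / G Dq] at
    [u = 0]. Here [G Dq] is the derivative of the moment generating function at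
    [- Dq], and [G 0] is the mean of [Lambda], computed from the primitive
    [- sigma ^+ 2 * normal_pdf mu sigma] of [(x - mu) * normal_pdf mu sigma x]. *)
Require Import Defs.
From HB Require Import structures.
From mathcomp Require Import all_boot all_order all_algebra.
From mathcomp Require Import all_classical all_reals all_analysis.
From mathcomp Require Import measurable_realfun ring.
Import Order.TTheory GRing.Theory Num.Theory.
Import numFieldNormedType.Exports.
Local Open Scope classical_set_scope.
Local Open Scope ring_scope.

(** * Integrals against a law given by a density *)

(** Null sets of [m] are null for [nu], so [nu] has a Radon-Nikodym derivative with respect to [m].
    It agrees with [p] almost everywhere, as both have the same integral over every measurable
    set. *)
Lemma integral_density {d} {T : measurableType d} {R : realType}
    (nu : {finite_measure set T -> \bar R})
    (m : {sigma_finite_measure set T -> \bar R}) (p : T -> R) :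
    measurable_fun setT p ->
    (forall A, measurable A -> nu A = (\int[m]_(x in A) (p x)%:E)%E) ->
  forall f : T -> \bar R, (forall x, 0 <= f x)%E -> measurable_fun setT f ->
  (\int[nu]_x f x = \int[m]_x (f x * (p x)%:E))%E.
Proof.
move=> mp nup f f0 mf.
have numu : nu `<< m.
  apply/null_content_dominatesP => A mA mA0; rewrite nup//.
  apply: null_set_integral => //; exact/measurable_funTS/measurable_EFinP.
rewrite -(Radon_Nikodym_SigmaFinite.change_of_variables numu)//.
have iRN := Radon_Nikodym_SigmaFinite.f_integrable numu.
apply: ae_eq_integral => //.
- by apply: emeasurable_funM => //; exact: measurable_int iRN.
- by apply: emeasurable_funM => //; exact/measurable_EFinP.
- apply: ae_eqe_mul2l; apply: integral_ae_eq => //; first exact/measurable_EFinP.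
  by move=> A _ mA; rewrite -Radon_Nikodym_SigmaFinite.f_integral// nup.
Qed.

(* Lebesgue measure lives on [measurableTypeR R], whose display differs from that
   of [R]; pushing [P] forward along the identity bridges the two. *)
Lemma integral_lebesgue_density {R : realType} (P : probability R R) (p : R -> R) :
    measurable_fun setT p ->
    (forall A, measurable A -> P A = (\int[lebesgue_measure]_(x in A) (p x)%:E)%E) ->
  forall f : R -> \bar R, (forall x, 0 <= f x)%E -> measurable_fun setT f ->
  (\int[P]_x f x = \int[lebesgue_measure]_x (f x * (p x)%:E))%E.
Proof.
move=> mp Pp f f0 mf; pose idT : R -> measurableTypeR R := idfun.
have mid : measurable_fun setT idT by exact: measurable_id.
pose X : {mfun R >-> measurableTypeR R} := HB.pack idT (isMeasurableFun.Build _ _ _ _ _ mid).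
rewrite -(@integral_density _ _ _ (distribution P X) lebesgue_measure p mp)//.
by rewrite ge0_integral_distribution.
Qed.

Lemma is_derive_expR_scale {R : realType} (x y : R) :
  is_derive x 1 (fun x => expR (x * y)) (y * expR (x * y)).
Proof.
have h : is_derive x 1 (fun x : R => x * y) y.
  by apply: is_derive_eq; rewrite /GRing.scale/= mulr1 mulr0 add0r.
have := @is_derive1_comp _ expR (fun x => x * y) x (expR (x * y)) y (is_derive_expR _) h.
by rewrite mulrC.
Qed.

(** * Laplace noise with a random, almost surely positive reciprocal scale *)

Section laplace_mixture.
Context {R : realType} (PL : probability R R).
Hypothesis PL_pos : PL `]-oo, 0]%classic = 0%E.

Let B : set R := `]0, +oo[%classic.

Let setC_B : ~` B = `]-oo, 0]%classic.
Proof. by rewrite /B -setCitvl setCK. Qed.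

Lemma integral_pos_support (f : R -> \bar R) :
    measurable_fun setT f -> (forall l, 0 <= f l)%E ->
  (\int[PL]_l f l = \int[PL]_(l in `]0%R, +oo[) f l)%E.
Proof.
move=> mf f0.
rewrite (@ge0_negligible_integral _ _ _ PL setT `]-oo, 0]%classic) => //.
by rewrite -setC_B setTD setCK.
Qed.

(** Writing [|l|] instead of [l] keeps the integrand nonnegative at every real [l], as Tonelli
    requires; the two agree [PL]-almost everywhere. *)
Definition mixture_density (c x : R) : \bar R :=
  (\int[PL]_l (`|l| / 2 * expR (- (l * `|x - c|)))%:E)%E.

(** The set [S] enters as an indicator factor, so that both iterated integrals run over the whole
    line. *)
Let kernel (c : R) (S : set R) (z : R * R) : \bar R :=
  ((`|z.1| / 2 * expR (- (z.1 * `|z.2 - c|)))%:E * (\1_S z.2)%:E)%E.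

Let kernel_ge0 c S z : (0 <= kernel c S z)%E.
Proof. by rewrite /kernel -EFinM lee_fin !mulr_ge0// expR_ge0. Qed.

Let measurable_kernel c S : measurable S -> measurable_fun setT (kernel c S).
Proof.
move=> mS; apply: emeasurable_funM; apply/measurable_EFinP.
  apply: measurable_funM.
    by apply: measurable_funM => //; exact: measurableT_comp.
  apply: measurableT_comp => //; apply: measurableT_comp => //.
  apply: measurable_funM; first exact: measurable_fst.
  by apply: measurableT_comp => //; exact: measurable_funB.
by apply: (measurableT_comp (measurable_indic mS)).
Qed.

Lemma measurable_mixture_density c : measurable_fun setT (mixture_density c).
Proof.
have := measurable_fun_fubini_tonelli_G (m1 := PL) _
  (measurable_kernel c _ measurableT) (kernel_ge0 c setT).
apply: eq_measurable_fun => x _; apply: eq_integral => l _.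
by rewrite /kernel/= indicT mule1.
Qed.

Lemma rlap_mechE (D : Type) (q : D -> R) d S : measurable S ->
  rlap_mech PL q d S = (\int[lebesgue_measure]_(x in S) mixture_density (q d) x)%E.
Proof.
move=> mS; pose c := q d.
have mk := measurable_kernel c _ mS.
have mh := measurable_fun_fubini_tonelli_F (m2 := lebesgue_measure) _ mk (kernel_ge0 c S).
set h := fubini_F _ _ in mh.
have hE l : h l = (\int[lebesgue_measure]_(x in S)
    (`|l| / 2 * expR (- (l * `|x - c|)))%:E)%E.
  rewrite integral_mkcond epatch_indic; exact: eq_integral.
rewrite /rlap_mech.
(* For negative [l] the integrand of [rlap_mech] is the opposite of the kernel, hence the sign; such
   [l] form a [PL]-null set, so the sign is then dropped. *)
rewrite [LHS](_ : _ = \int[PL]_l (if (0 <= l)%R then h l else - h l))%E; last first.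
  apply: eq_integral => l _; case: ifPn => [l0|].
    by rewrite hE ger0_norm.
  rewrite -ltNge => l0; rewrite hE -integral_ge0N/=; last first.
    by move=> x _; rewrite lee_fin !mulr_ge0// expR_ge0.
  by apply: eq_integral => x _; rewrite (ltr0_norm l0) !mulNr opprK.
have mF : measurable_fun setT (fun l : R => if 0 <= l then h l else (- h l)%E).
  apply: measurable_fun_ifT => //; last exact: measurableT_comp.
  exact: measurable_fun_ler.
have -> : (\int[PL]_l (if (0 <= l)%R then h l else - h l) = \int[PL]_l h l)%E.
  apply: ae_eq_integral => //; exists `]-oo, 0]%classic; split => //= l/=.
  rewrite in_itv/= => /not_implyP[_]; case: ifPn => //.
  by rewrite -ltNge => /ltW.
transitivity (\int[lebesgue_measure]_x fubini_G PL (kernel c S) x)%E.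
  exact: (fubini_tonelli (m1 := PL) (m2 := lebesgue_measure) _ mk (kernel_ge0 c S)).
rewrite [RHS]integral_mkcond epatch_indic; apply: eq_integral => x _.
rewrite /fubini_G /kernel/= ge0_integralZr//.
apply/measurable_EFinP; apply: measurable_funM.
    by apply: measurable_funM => //; exact: measurableT_comp.
  apply: measurableT_comp => //; apply: measurableT_comp => //.
  exact: measurable_funM.
Qed.

Hypothesis integrable_scale : PL.-integrable B (EFin \o id).

Let mB : measurable B. Proof. exact: measurable_itv. Qed.

Let PL_B : PL B = 1%E.
Proof.
have -> : B = ~` `]-oo, 0]%classic by rewrite -setC_B setCK.
by rewrite probability_setC// PL_pos sube0.
Qed.

(** The function [G] of the overview. On positive [l] and for [u >= 0], its integrand is positive
    and dominated by [l]. *)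
Definition exp_moment (u : R) : R :=
  \int[PL]_(l in `]0%R, +oo[) (l * expR (- (l * u))).

Let measurable_exp_moment (u : R) :
  measurable_fun setT (fun l : R => l * expR (- (l * u))).
Proof.
apply: measurable_funM => //; apply: measurableT_comp => //.
by apply: measurableT_comp => //; exact: measurable_funM.
Qed.

Let integrable_exp_moment (u : R) : 0 <= u ->
  PL.-integrable B (EFin \o (fun l => l * expR (- (l * u)))).
Proof.
move=> u0; apply: (le_integrable mB) integrable_scale.
  exact/measurable_EFinP/measurable_funTS.
move=> l; rewrite /B/= in_itv/= andbT => l0.
rewrite lee_fin !ger0_norm ?mulr_ge0 ?expR_ge0// ?(ltW l0)//.
by rewrite ler_piMr ?(ltW l0)// -expR0 ler_expR oppr_le0 mulr_ge0// ltW.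
Qed.

Lemma mixture_densityE c x : mixture_density c x = (exp_moment `|x - c| / 2)%:E.
Proof.
rewrite /mixture_density integral_pos_support; last 2 first.
- apply/measurable_EFinP; apply: measurable_funM.
    by apply: measurable_funM => //; exact: measurableT_comp.
  apply: measurableT_comp => //; apply: measurableT_comp => //.
  exact: measurable_funM.
- by move=> l; rewrite lee_fin mulr_ge0// expR_ge0.
rewrite mulrC /exp_moment -RintegralZl//; last exact: integrable_exp_moment.
rewrite fineK; last first.
  apply: integrable_fin_num => //; apply: (eq_integrable mB); last first.
    apply: (integrableZl mB 2^-1); exact: (@integrable_exp_moment `|x - c|).
  by move=> l _; rewrite /= EFinM.
apply: eq_integral => l; rewrite inE/= in_itv/= andbT => l0.
by rewrite gtr0_norm// mulrA (mulrC l).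
Qed.

(** The integrand is positive on [B], so a zero integral would make [B] a null set, whereas
    [PL B = 1]. *)
Lemma exp_moment_gt0 u : 0 <= u -> 0 < exp_moment u.
Proof.
move=> u0; have ge0 : forall l, B l -> 0 <= l * expR (- (l * u)).
  by move=> l; rewrite /B/= in_itv/= andbT => l0; rewrite mulr_ge0 ?expR_ge0// ltW.
rewrite lt_neqAle Rintegral_ge0// andbT; apply/eqP => G0.
have : (\int[PL]_(l in B) `|(l * expR (- (l * u)))%:E| = 0)%E.
  transitivity (exp_moment u)%:E; last by rewrite -G0.
  rewrite /exp_moment /Rintegral fineK; last first.
    exact: (integrable_fin_num mB (integrable_exp_moment _ u0)).
  by apply: eq_integral => l; rewrite inE => Bl; rewrite gee0_abs// lee_fin ge0.
move/ae_eq_integral_abs => /(_ mB); case.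
  exact/measurable_EFinP/measurable_funTS.
move=> N [mN PN0 subN].
have : (PL B <= PL N)%E.
  apply: le_measure; rewrite ?inE// => l Bl; apply: subN => /= /(_ Bl)[].
  move: Bl; rewrite /B/= in_itv/= andbT => l0 /eqP.
  by rewrite mulf_eq0 gt_eqF//= gt_eqF ?expR_gt0.
by rewrite PN0 PL_B lee_fin ler10.
Qed.

Lemma exp_moment_le u v : 0 <= u -> u <= v -> exp_moment v <= exp_moment u.
Proof.
move=> u0 uv; apply: le_Rintegral => //.
- exact/integrable_exp_moment/(le_trans u0).
- exact: integrable_exp_moment.
move=> l; rewrite /= in_itv/= andbT => l0.
by rewrite ler_pM2l// ler_expR lerN2 ler_pM2l.
Qed.

(* With [r] the mean of [exp (- (l * D))] under the probability proportional to
   [l * PL], the factors [exp (- (l * D)) - r] and [exp (- (l * u)) - exp (- (l0 * u))]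
   have the same sign, where [exp (- (l0 * D)) = r]; integrating their product
   gives the Chebyshev association inequality. *)
Lemma exp_moment_chebyshev u D : 0 <= u -> 0 < D ->
  exp_moment u * exp_moment D <= exp_moment 0 * exp_moment (u + D).
Proof.
move=> u0 D0; have [G GE] : exists G, forall v, exp_moment v = G v by exists exp_moment.
have m0 : 0 < G 0 by rewrite -GE exp_moment_gt0.
have gD0 : 0 < G D by rewrite -GE exp_moment_gt0// ltW.
rewrite !GE; pose r := G D / G 0.
have r0 : 0 < r by exact: divr_gt0.
pose l0 := - ln r / D.
have l0r : expR (- (l0 * D)) = r by rewrite mulrVK ?unitfE ?gt_eqF// opprK lnK.
pose e := expR (- (l0 * u)).
have iG v := @integrable_exp_moment v.
have uD0 : 0 <= u + D by rewrite addr_ge0// ltW.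
(* The product of the two factors, weighted by [l], is [f1 l - f2 l]. The choice of [r] makes the
   integral of [f2] vanish, so that of [f1], namely [G (u + D) - r * G u], is nonnegative. *)
pose f1 l := l * expR (- (l * (u + D))) - r * (l * expR (- (l * u))).
pose f2 l := e * (l * expR (- (l * D)) - r * (l * expR (- (l * 0)))).
have iZ (k : R) (f : R -> R) : PL.-integrable B (EFin \o f) ->
    PL.-integrable B (EFin \o (fun l => k * f l)).
  move=> fi; apply: (eq_integrable mB); last exact: (integrableZl mB k fi).
  by move=> l _; rewrite /= EFinM.
have iB (f g : R -> R) : PL.-integrable B (EFin \o f) ->
    PL.-integrable B (EFin \o g) -> PL.-integrable B (EFin \o (fun l => f l - g l)).
  move=> fi gi; apply: (eq_integrable mB); last exact: (integrableB mB fi gi).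
  by move=> l _; rewrite /= EFinB.
have if1 : PL.-integrable B (EFin \o f1).
  by apply: iB; [exact: iG|apply: iZ; exact: iG].
have if2' : PL.-integrable B (EFin \o (fun l => l * expR (- (l * D)) - r * (l * expR (- (l * 0))))).
  by apply: iB; [apply: iG; exact: ltW|apply: iZ; exact: iG].
have if2 : PL.-integrable B (EFin \o f2) by exact: iZ.
have : 0 <= \int[PL]_(l in B) (f1 l - f2 l).
  apply: Rintegral_ge0 => l; rewrite /B/= in_itv/= andbT => lgt0.
  rewrite [leRHS](_ : _ = l * ((expR (- (l * D)) - expR (- (l0 * D))) *
      (expR (- (l * u)) - expR (- (l0 * u))))); last first.
    rewrite l0r /f1 /f2 -/e mulr0 oppr0 expR0 mulrDr opprD expRD; ring.
  rewrite mulr_ge0 ?(ltW lgt0)//.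
  have [ll|ll] := leP l l0.
    by rewrite mulr_ge0// subr_ge0 ler_expR lerN2 ler_wpM2r// ltW.
  by rewrite mulr_le0// subr_le0 ler_expR lerN2 ler_wpM2r// ltW.
rewrite (RintegralB mB if1 if2) /f1 /f2 (RintegralZl _ mB if2').
rewrite (RintegralB mB (iG _ uD0) (iZ r _ (iG _ u0))).
rewrite (RintegralB mB (iG _ (ltW D0)) (iZ r _ (iG _ (lexx 0)))).
rewrite (RintegralZl _ mB (iG _ u0)) (RintegralZl _ mB (iG _ (lexx 0))).
rewrite -!/(exp_moment _) !GE divfK ?gt_eqF// subrr mulr0 subr0.
by rewrite subr_ge0 /r mulrAC ler_pdivrMr// mulrC (mulrC (G 0)).
Qed.

(** Differentiation under the integral sign. For [s] in []t - 1, 0[] and [l > 0] the partial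
    derivative [l * expR (s * l)] is dominated by [|l|], which is integrable. *)
Lemma mgf_derive1 t : t < 0 -> derive1 (mgf PL) t = exp_moment (- t).
Proof.
move=> t0.
have -> : mgf PL = fun t => \int[PL]_(l in B) expR (t * l).
  apply/funext => s; rewrite /mgf integral_pos_support//.
  by apply/measurable_EFinP; apply: measurableT_comp => //; exact: measurable_funM.
have It : `]t - 1, 0[%classic t by rewrite /= in_itv/= t0 andbT ltrBlDr ltrDl.
rewrite (differentiation_under_integral (f := fun s l => expR (s * l)) mB It
  _ _ (G := fun l : R => `|l|))//=.
- apply: eq_Rintegral => l _; rewrite /partial1of2 derive1E.
  by rewrite (@derive_val _ _ _ _ _ _ _ (is_derive_expR_scale t l)) mulrN opprK [t * l]mulrC.
- move=> x /[!in_itv]/= /andP[_ x0]; apply: measurable_bounded_integrable => //.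
  + by apply: le_lt_trans (probability_le1 _ mB) _; rewrite ltry.
  + by apply: measurableT_comp => //; exact: measurable_funM.
  + exists 1; split => // M M1 l; rewrite /B/= in_itv/= andbT => l0.
    rewrite ger0_norm ?expR_ge0// (le_trans _ (ltW M1))// -expR0 ler_expR.
    by rewrite nmulr_rle0// ltW.
- exact: integrable_norm integrable_scale.
- move=> x l /[!in_itv]/= /andP[_ x0]; rewrite /B/= in_itv/= andbT => l0.
  rewrite /partial1of2 derive1E (@derive_val _ _ _ _ _ _ _ (is_derive_expR_scale x l)).
  rewrite !ger0_norm ?mulr_ge0 ?expR_ge0 ?(ltW l0)//.
  by rewrite ler_piMr ?(ltW l0)// -expR0 ler_expR nmulr_rle0// ltW.
Qed.

(** Any upper bound [C] on the mean of the reciprocal scale will do, since a larger [C] only weakens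
    the privacy guarantee; for the truncated Gaussian only such a bound is established. *)
Lemma rlap_mech_eps_DP (D : Type) (adj : D -> D -> Prop) (q : D -> R) (Dq C : R) :
    (forall d d', adj d d' -> `|q d - q d'| <= Dq) -> 0 < Dq ->
    exp_moment 0 <= C ->
  eps_DP adj (rlap_mech PL q) (ln (C / derive1 (mgf PL) (- Dq))).
Proof.
move=> adjq Dq0 C0 d d' dd' S mS.
have [G GE] : exists G, forall v, exp_moment v = G v by exists exp_moment.
have Dqn : - Dq < 0 by rewrite oppr_lt0.
have G0 : 0 < G 0 by rewrite -GE exp_moment_gt0.
have GD0 : 0 < G Dq by rewrite -GE exp_moment_gt0// ltW.
have GC : G 0 <= C by rewrite -GE.
rewrite mgf_derive1// opprK GE lnK; last first.
  by rewrite posrE divr_gt0// (lt_le_trans G0).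
rewrite !rlap_mechE// -ge0_integralZl//; last 3 first.
- by apply: measurable_funTS; exact: measurable_mixture_density.
- by move=> x _; rewrite mixture_densityE lee_fin divr_ge0// ltW// exp_moment_gt0.
- by rewrite lee_fin divr_ge0// ltW// (lt_le_trans G0).
apply: ge0_le_integral => //.
- by move=> x _; rewrite mixture_densityE lee_fin divr_ge0// ltW// exp_moment_gt0.
- by apply: measurable_funTS; exact: measurable_mixture_density.
- apply: emeasurable_funM => //.
  by apply: measurable_funTS; exact: measurable_mixture_density.
move=> x _; rewrite !mixture_densityE -EFinM lee_fin mulrA ler_pM2r//.
set u := `|x - q d|; set v := `|x - q d'|.
have vu : v <= u + Dq.
  rewrite (le_trans (ler_distD (q d) _ _))// lerD2l; exact: adjq.
have u0 : 0 <= u by exact: normr_ge0.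
(* The chain is [G u * G Dq <= G 0 * G (u + Dq) <= C * G v]: association first, then monotonicity
   along [v <= u + Dq]. *)
have := exp_moment_chebyshev _ _ u0 Dq0.
have := exp_moment_le _ _ (normr_ge0 _ : 0 <= v) vu.
rewrite !GE => Gvu GuD.
rewrite mulrAC ler_pdivlMr// (le_trans GuD)// ler_pM// ltW// -GE exp_moment_gt0//.
by rewrite addr_ge0// ltW.
Qed.
End laplace_mixture.

(** * First moments of the normal density over an interval *)

Section truncated_normal.
Context {R : realType} (m s : R).
Hypothesis s0 : 0 < s.
Let N := normal_pdf m s.

Let sn0 : s != 0. Proof. exact: lt0r_neq0. Qed.

Let NE : N = fun x => normal_peak s * normal_fun m s x.
Proof. by apply/funext => x; rewrite /N /normal_pdf (negbTE sn0). Qed.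

Lemma is_derive_normal_pdf (x : R) :
  is_derive x 1 (normal_pdf m s) (- ((x - m) / s ^+ 2 * normal_pdf m s x)).
Proof.
have h : is_derive x 1 (fun x : R => - (x - m) ^+ 2 / (s ^+ 2 *+ 2))
    (- ((x - m) / s ^+ 2)).
  by apply: is_derive_eq; rewrite /GRing.scale/=; field.
have h' := @is_derive1_comp _ expR _ x _ _ (is_derive_expR _) h.
rewrite -/N NE; apply: (is_derive_eq (is_deriveZ (normal_peak s) h')).
by rewrite /GRing.scale/= /normal_fun; ring.
Qed.

Let contN : continuous N.
Proof. exact: continuous_normal_pdf. Qed.

Let cont_center_N : continuous (fun x => (x - m) * N x).
Proof.
move=> x; apply: cvgM; last exact: contN.
by apply: cvgB; [exact: cvg_id|exact: cvg_cst].
Qed.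

Lemma integral_center_normal_pdf (a c : R) : a < c ->
  (\int[lebesgue_measure]_(x in `[a, c]) ((x - m) * normal_pdf m s x)%:E)%E =
  (s ^+ 2 * (normal_pdf m s a - normal_pdf m s c))%:E.
Proof.
move=> ac; pose F x := - s ^+ 2 * N x.
have dF (x : R) : is_derive x 1 F ((x - m) * N x).
  apply: (is_derive_eq (is_deriveZ (- s ^+ 2) (is_derive_normal_pdf x))).
  by rewrite /GRing.scale/= -/N; field.
have cF : continuous F.
  by move=> x; apply: cvgM; [exact: cvg_cst|exact: contN].
rewrite (@continuous_FTC2 _ _ F)//.
- by rewrite -EFinB /F; congr EFin; rewrite /N; ring.
- exact: continuous_subspaceT.
- split.
  + by move=> x _; have [] := dF x.
  + by apply: cvg_at_right_filter; exact: cF.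
  + by apply: cvg_at_left_filter; exact: cF.
- by move=> x _; rewrite derive1E; have [_] := dF x.
Qed.

Let integrable_segment (f : R -> R) (a c : R) : continuous f ->
  lebesgue_measure.-integrable `[a, c] (EFin \o f).
Proof.
move=> cf; apply: continuous_compact_integrable; first exact: segment_compact.
exact: continuous_subspaceT.
Qed.

(** Split [x] as [m + (x - m)]; the centred part integrates in closed form. *)
Lemma integral_id_normal_pdf (a c : R) : a < c ->
  (\int[lebesgue_measure]_(x in `[a, c]) (x * normal_pdf m s x)%:E =
   m%:E * \int[lebesgue_measure]_(x in `[a, c]) (normal_pdf m s x)%:E +
   (s ^+ 2 * (normal_pdf m s a - normal_pdf m s c))%:E)%E.
Proof.
move=> ac; rewrite -integral_center_normal_pdf//.
rewrite -integralZl//; last exact: integrable_segment.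
rewrite -integralD//.
- by apply: eq_integral => x _; rewrite -EFinM -EFinD; congr EFin; ring.
- by apply: integrableZl => //; exact: integrable_segment.
- exact: integrable_segment.
Qed.

(** Turns the boundary terms [s ^+ 2 * normal_pdf m s x] into [s * std_phi], the form used in the
    privacy bound. *)
Lemma normal_pdf_std (x : R) : s * normal_pdf m s x = std_phi ((x - m) / s).
Proof.
rewrite /std_phi -/N NE normal_pdfE ?oner_eq0// /normal_fun /normal_peak.
rewrite subr0 expr1n mul1r mulrA; congr (_ * expR _); last by field.
rewrite -mulrnAr sqrtrM ?sqr_ge0// sqrtr_sqr gtr0_norm// invfM mulrA divff//.
by rewrite mul1r.
Qed.

(* An upper bound suffices, and for [b = +oo] dropping the nonpositive boundary
   term at the right end spares the limit of the density. *)
Lemma integral_id_normal_pdf_le (a : R) (b : \bar R) : 0 <= a -> (a%:E < b)%E ->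
  (\int[lebesgue_measure]_(x in itv_ab a b) (x * normal_pdf m s x)%:E <=
   m%:E * \int[lebesgue_measure]_(x in itv_ab a b) (normal_pdf m s x)%:E +
   (s * (std_phi ((a - m) / s) - std_phi_bar ((b - m%:E) * (s^-1)%:E)%E))%:E)%E.
Proof.
move=> a0; case: b => [b| |]//.
  rewrite lte_fin => ab.
  have -> : itv_ab a b%:E = `[a, b]%classic.
    by apply/seteqP; split=> x; rewrite /itv_ab/= in_itv/= lee_fin => /andP.
  rewrite integral_id_normal_pdf//= -!normal_pdf_std.
  by rewrite -mulrBr mulrA expr2.
move=> _; have -> : itv_ab a +oo = `[a, +oo[%classic.
  apply/seteqP; split=> x; rewrite /itv_ab/= in_itv/= andbT; first by case.
  by rewrite leey.
(* The standardized right endpoint is again [+oo], where [std_phi_bar] is 0. *)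
rewrite gt0_mulye ?lte_fin ?invr_gt0//=.
rewrite subr0 -normal_pdf_std mulrA -expr2.
(* Exhaust the half-line by the segments [[a, a + k]] and pass to the limit in both integrals by
   monotone convergence. *)
rewrite itv_bndy_bigcup_BRight.
have nd : {homo (fun n : nat => `[a, a + n%:R]%classic) : n k / (n <= k)%N >-> (n <= k)%O}.
  move=> n k nk; apply/subsetPset/subset_itvl.
  by rewrite bnd_simp lerD2l ler_nat.
have mN k : measurable_fun `[a, a + k%:R] N.
  by apply/measurable_funTS; exact: measurable_normal_pdf.
set I := \bigcup_n _.
have c1 : (\int[lebesgue_measure]_(x in `[a, (a + k%:R)%R]) (x * N x)%:E @[k --> \oo] -->
    \int[lebesgue_measure]_(x in I) (x * N x)%:E)%E.
  apply: ge0_nondecreasing_set_cvg_integral => // [k|k x].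
    by apply/measurable_EFinP; apply: measurable_funM => //; exact: mN.
  rewrite /= in_itv/= => /andP[ax _].
  by rewrite lee_fin mulr_ge0// ?normal_pdf_ge0// (le_trans a0).
have c2 : (\int[lebesgue_measure]_(x in `[a, (a + k%:R)%R]) (N x)%:E @[k --> \oo] -->
    \int[lebesgue_measure]_(x in I) (N x)%:E)%E.
  apply: ge0_nondecreasing_set_cvg_integral => // [k|k x _].
    by apply/measurable_EFinP; exact: mN.
  by rewrite lee_fin normal_pdf_ge0.
have c3 : (m%:E * \int[lebesgue_measure]_(x in `[a, (a + k%:R)%R]) (N x)%:E +
      (s ^+ 2 * N a)%:E @[k --> \oo] -->
    m%:E * \int[lebesgue_measure]_(x in I) (N x)%:E + (s ^+ 2 * N a)%:E)%E.
  by apply: cvgeD; [exact: fin_num_adde_defl|exact: cvgeZl|exact: cvg_cst].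
rewrite -(cvg_lim _ c1)// -(cvg_lim _ c3)//.
apply: lee_lim; [exact: cvgP c1|exact: cvgP c3|].
(* The closed form requires a nondegenerate segment, hence [k > 0]. *)
near=> k; rewrite integral_id_normal_pdf; last first.
  by rewrite ltrDl ltr0n; near: k; exact: nbhs_infty_gt.
rewrite leeD2l// lee_fin ler_wpM2l ?sqr_ge0// gerBl.
exact: normal_pdf_ge0.
Unshelve. all: by end_near. Qed.
End truncated_normal.

(** * Normalization, support and mean of the truncated Gaussian *)

Section truncated_gauss_law.
Context {R : realType} (mu sigma a : R) (b : \bar R) (PL : probability R R).
Hypotheses (s0 : 0 < sigma) (a0 : 0 <= a) (ab : (a%:E < b)%E).
Let p := trunc_gauss_pdf mu sigma a b.
Hypothesis PLE : forall A : set R, measurable A ->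
  PL A = (\int[lebesgue_measure]_(x in A) (p x)%:E)%E.
Let alpha := ((a - mu) / sigma)%:E.
Let beta := ((b - mu%:E) * (sigma^-1)%:E)%E.
Let Z := std_Phi beta - std_Phi alpha.
Let N := normal_pdf mu sigma.

Let measurable_I : measurable (itv_ab a b).
Proof.
rewrite (_ : itv_ab a b = `[a, +oo[ `&` [set x | (x%:E <= b)%E]); last first.
  by apply/seteqP; split=> x; rewrite /itv_ab/= in_itv/= andbT.
apply: measurableI => //; rewrite -[X in measurable X]setTI.
exact: emeasurable_fun_infty_c.
Qed.

Let pE x : p x = Z^-1 * (N x * \1_(itv_ab a b) x).
Proof.
rewrite /p /trunc_gauss_pdf indicE.
case: asboolP => [Ix|nIx].
  by rewrite mem_set// mulr1 mulrC.
by rewrite memNset// !mulr0.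
Qed.

Let measurable_p : measurable_fun setT p.
Proof.
rewrite (funext pE); apply: measurable_funM => //; apply: measurable_funM.
  exact: measurable_normal_pdf.
exact: measurable_indic.
Qed.

(** Comes from the total mass of [PL], without studying [std_Phi]: if [Z <= 0], then [Z^-1 <= 0]
    (with [0^-1 = 0]), so the density is nonpositive and cannot integrate to 1. *)
Let Z0 : 0 < Z.
Proof.
rewrite ltNge; apply/negP => Zle0.
have := PLE _ measurableT; rewrite probability_setT => /esym P1.
have : (\int[lebesgue_measure]_x (p x)%:E <= 0)%E.
  have Np0 x : setT x -> (0 <= (- p x)%:E)%E.
    move=> _; rewrite lee_fin oppr_ge0 pE.
    by rewrite mulr_le0_ge0 ?invr_le0// mulr_ge0// normal_pdf_ge0.
  have -> : (\int[lebesgue_measure]_x (p x)%:E =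
      \int[lebesgue_measure]_x - (- p x)%:E)%E.
    by apply: eq_integral => x _; rewrite -EFinN opprK.
  by rewrite integral_ge0N// oppe_le0 integral_ge0.
by rewrite P1 lee_fin ler10.
Qed.

Let integral_density_mul (h : R -> R) : measurable_fun setT h ->
    (forall x, itv_ab a b x -> 0 <= h x) ->
  (\int[lebesgue_measure]_x (h x * p x)%:E =
   (Z^-1)%:E * \int[lebesgue_measure]_(x in itv_ab a b) (h x * N x)%:E)%E.
Proof.
move=> mh h0; have mN := @measurable_normal_pdf R mu sigma.
rewrite -ge0_integralZl//.
- rewrite [RHS]integral_mkcond; apply: eq_integral => x _.
  rewrite epatch_indic -!EFinM pE; congr EFin; ring.
- by apply/measurable_EFinP/measurable_funTS; exact: measurable_funM.
- by move=> x Ix; rewrite lee_fin mulr_ge0 ?normal_pdf_ge0// h0.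
- by rewrite lee_fin invr_ge0 ltW.
Qed.

(** Again read off from the total mass 1 of [PL], which replaces a change of variables to the
    standard normal. *)
Let mass_I : (\int[lebesgue_measure]_(x in itv_ab a b) (N x)%:E = Z%:E)%E.
Proof.
have := integral_density_mul (cst 1) (measurable_cst _) (fun _ _ => ler01).
under eq_integral do rewrite mul1r.
rewrite -PLE// probability_setT.
under eq_integral do rewrite mul1r.
by move=> /(congr1 (mule Z%:E)); rewrite mule1 muleA -EFinM divff ?gt_eqF// mul1e.
Qed.

Lemma trunc_gauss_nonpos : PL `]-oo, 0]%classic = 0%E.
Proof.
(* If [a = 0] the density does not vanish at 0, so this Lebesgue-null endpoint is removed first. *)
rewrite PLE// -integral_itv_bndo_bndc//; last exact/measurable_EFinP/measurable_funTS.
apply: integral0_eq => x; rewrite /= in_itv/= => x0.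
rewrite pE indicE memNset ?mulr0// /itv_ab/= => -[ax _].
by move: (le_lt_trans (le_trans a0 ax) x0); rewrite ltxx.
Qed.

(** With the absolute value, the bound serves twice: it makes the identity integrable under [PL],
    and it bounds [G 0]. *)
Lemma trunc_gauss_mean_le :
  (\int[PL]_l (`|l|)%:E <=
   (mu + sigma * (std_phi_bar alpha - std_phi_bar beta) / Z)%:E)%E.
Proof.
rewrite (integral_lebesgue_density _ _ measurable_p PLE)//; last first.
  by apply/measurable_EFinP; exact: normr_measurable.
under eq_integral do rewrite -EFinM.
rewrite (integral_density_mul (fun l => `|l|))//.
have -> : (\int[lebesgue_measure]_(x in itv_ab a b) (`|x| * N x)%:E =
    \int[lebesgue_measure]_(x in itv_ab a b) (x * N x)%:E)%E.
  apply: eq_integral => x; rewrite inE => -[ax _].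
  by rewrite ger0_norm// (le_trans a0).
have := integral_id_normal_pdf_le mu _ s0 _ _ a0 ab.
rewrite mass_I -EFinM -EFinD => /(@lee_wpmul2l _ (Z^-1)%:E).
rewrite lee_fin invr_ge0 => /(_ (ltW Z0)) /le_trans; apply.
rewrite -EFinM lee_fin mulrDr mulrCA mulVf ?gt_eqF// mulr1.
by rewrite [Z^-1 * _]mulrC.
Qed.

End truncated_gauss_law.

Theorem mainTheorem13 (R : realType) (D : Type) (adj : D -> D -> Prop)
  (q : D -> R) (Dq : R) (mu sigma a : R) (b : \bar R)
  (PL : probability R R) :
  (forall d d', adj d d' -> adj d' d) ->
  sensitivity adj q = Dq%:E -> 0 < Dq ->
  0 < sigma -> 0 <= a -> (a%:E < b)%E ->
  (forall A : set R, measurable A ->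
     PL A = (\int[lebesgue_measure]_(x in A) (trunc_gauss_pdf mu sigma a b x)%:E)%E) ->
  let alpha := ((a - mu) / sigma)%:E in
  let beta := ((b - mu%:E) * (sigma^-1)%:E)%E in
  let eps := ln ((mu + sigma * (std_phi_bar alpha - std_phi_bar beta)
                        / (std_Phi beta - std_Phi alpha))
                 / (derive1 (mgf PL) (- Dq))) in
  eps_DP adj (rlap_mech PL q) eps.
Proof.
move=> _ sensq Dq0 s0 a0 ab PLE alpha beta eps.
have PL0 := trunc_gauss_nonpos mu sigma a b PL a0 PLE.
have mean_le := trunc_gauss_mean_le mu sigma a b PL s0 a0 ab PLE.
have mnorm : measurable_fun setT (fun l : R => `|l|%:E).
  by apply/measurable_EFinP; exact: normr_measurable.
have iL : PL.-integrable `]0, +oo[ (EFin \o id).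
  apply: (integrableS measurableT) => //; apply/integrableP; split.
    exact/measurable_EFinP.
  by apply: le_lt_trans mean_le _; rewrite ltry.
apply: rlap_mech_eps_DP => // [d d' dd'|].
  by rewrite -lee_fin -sensq; apply: ereal_sup_ubound; exists d, d'.
(* At [u = 0] the exponential factor is 1, and [PL] is carried by the positive half-line, so [G 0]
   is the mean just bounded. *)
have e0 : (\int[PL]_(l in `]0%R, +oo[) (l * expR (- (l * 0)))%:E = \int[PL]_l `|l|%:E)%E.
  rewrite (integral_pos_support PL PL0)//; apply: eq_integral => l.
  by rewrite inE/= in_itv/= andbT mulr0 oppr0 expR0 mulr1 => l0; rewrite gtr0_norm.
rewrite /exp_moment /Rintegral e0 -lee_fin fineK//.
rewrite ge0_fin_numE ?(le_lt_trans mean_le) ?ltry//.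
by apply: integral_ge0 => l _; rewrite lee_fin.
Qed.
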